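(* For complex sequences $\{a_0,a_1,\ldots\}$ with all $a_i\neq 0$ and $\{b_1,b_2,\ldots\}$, and a control $f\in\mathcal{F}^\infty$, let $u^f_{n,t}$ be the solution of $$\begin{cases} u_{n,t+1}+u_{n,t-1}-a_n u_{n+1,t}-a_{n-1}u_{n-1,t}-b_n u_{n,t}=0,& n\in\mathbb{N},\ t\in\mathbb{N}\cup\{0\},\\ u_{n,-1}=u_{n,0}=0,& n\in\mathbb{N},\\ u_{0,t}=f_t,& t\in\mathbb{N}\cup\{0\}.\end{cases}$$ Then: 1) For every $f\in\mathcal{F}^\infty$ and $n,t\in\mathbb{N}$, the value $u^f_{n,t}$, regarded as a function of the coefficients, is odd with respect to each of $a_1,a_2,\ldots,a_{n-1}$ and even with respect to each of $a_n,a_{n+1},\ldots$. 2) The response vector $(r_0,r_1,r_2,\ldots)$ depends on the coefficients $a_1,a_2,\ldots$ only through their squares $(a_1)^2,(a_2)^2,\ldots$.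
   Context: $\mathbb{N}=\{1,2,\ldots\}$. $\mathcal{F}^\infty=\mathbb{C}^\infty$ is the space of all complex sequences $f=(f_0,f_1,\ldots)$. Odd (respectively even) with respect to $a_j$ means that replacing $a_j$ by $-a_j$, with $f$ and all other coefficients $a_i$ ($i\ne j$) and $b_i$ fixed, multiplies the value by $-1$ (respectively leaves it unchanged). The response vector is $r_k=u^\delta_{1,k+1}$, $k=0,1,2,\ldots$, where $\delta=(1,0,0,\ldots)$. *)

(* Defs.v *)
From mathcomp Require Import all_boot all_order all_algebra.
From mathcomp Require Import reals.
From mathcomp Require Import complex ring.
Set Implicit Arguments.
Unset Strict Implicit.
Unset Printing Implicit Defensive.
Import Order.TTheory GRing.Theory Num.Theory.
Local Open Scope ring_scope.
Local Open Scope complex_scope.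

Definition nonvanishing (R : realType) (a : nat -> R[i]) : Prop :=
  forall i : nat, a i != 0.

(* Space is indexed by nat (n = 0 is the boundary), time by int so that the
   initial layer t = -1 is available.  The values u n t with t < -1, the value
   u 0 (-1) and the coefficient b 0 are not constrained or used. *)
Record is_solution (R : realType) (a b f : nat -> R[i])
    (u : nat -> int -> R[i]) : Prop := IsSolution {
  solution_eq : forall n t : nat, (0 < n)%N ->
    u n (t%:Z + 1) + u n (t%:Z - 1) - a n * u n.+1 t%:Z
      - a n.-1 * u n.-1 t%:Z - b n * u n t%:Z = 0;
  solution_init : forall n : nat, (0 < n)%N ->
    u n (-1) = 0 /\ u n 0 = 0;
  solution_boundary : forall t : nat, u 0%N t%:Z = f t
}.

(* A choice, for all admissible coefficients and all controls, of a solution;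
   by solution_map_exists and solution_unique below there is exactly one on the
   range of indices that matters. *)
Definition solution_map (R : realType)
    (u : (nat -> R[i]) -> (nat -> R[i]) -> (nat -> R[i]) ->
         nat -> int -> R[i]) : Prop :=
  forall a b f : nat -> R[i], nonvanishing a -> is_solution a b f (u a b f).

Definition flip_sign (R : realType) (j : nat) (a : nat -> R[i]) : nat -> R[i] :=
  fun i => if i == j then - a i else a i.

Definition odd_wrt (R : realType) (j : nat) (F : (nat -> R[i]) -> R[i]) : Prop :=
  forall a : nat -> R[i], nonvanishing a -> F (flip_sign j a) = - F a.

Definition even_wrt (R : realType) (j : nat) (F : (nat -> R[i]) -> R[i]) : Prop :=
  forall a : nat -> R[i], nonvanishing a -> F (flip_sign j a) = F a.

Definition delta (R : realType) : nat -> R[i] := fun t => (t == 0%N)%:R.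

Definition response (R : realType)
    (u : (nat -> R[i]) -> (nat -> R[i]) -> (nat -> R[i]) ->
         nat -> int -> R[i])
    (a b : nat -> R[i]) : nat -> R[i] :=
  fun k => u a b (delta R) 1%N (k.+1)%:Z.

Fixpoint layer (R : realType) (a b f : nat -> R[i]) (t n : nat) : R[i] :=
  if n == 0%N then f t else
  match t with
  | 0 => 0
  | t1.+1 => a n * layer a b f t1 n.+1 + a n.-1 * layer a b f t1 n.-1
             + b n * layer a b f t1 n
             - match t1 with 0 => 0 | t2.+1 => layer a b f t2 n end
  end.

Lemma solution_map_exists (R : realType) :
  exists u : (nat -> R[i]) -> (nat -> R[i]) -> (nat -> R[i]) ->
             nat -> int -> R[i], solution_map u.
Proof.
exists (fun a b f n t => if t is Posz t' then layer a b f t' n else 0).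
move=> a b f _; split.
- case=> [//|n] t _.
  have -> : t%:Z + 1 = t.+1%:Z by rewrite -PoszD addn1.
  case: t => [|t].
    have -> : layer a b f 1 n.+1 =
        a n.+1 * layer a b f 0 n.+2 + a n * layer a b f 0 n
        + b n.+1 * layer a b f 0 n.+1 - 0 by [].
    have -> : 0%:Z - 1 = Negz 0 by [].
    by rewrite [n.+1.-1]/=; ring.
  have -> : t.+1%:Z - 1 = t%:Z by rewrite -addn1 PoszD addrK.
  have -> : layer a b f t.+2 n.+1 =
      a n.+1 * layer a b f t.+1 n.+2 + a n * layer a b f t.+1 n
      + b n.+1 * layer a b f t.+1 n.+1 - layer a b f t n.+1 by [].
  by rewrite [n.+1.-1]/=; ring.
- by case.
- by case=> [|t].
Qed.

Lemma solution_unique (R : realType) (a b f : nat -> R[i])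
    (u v : nat -> int -> R[i]) :
  is_solution a b f u -> is_solution a b f v ->
  forall n t : nat, u n t%:Z = v n t%:Z.
Proof.
move=> [eu iu bu] [ev iv bv].
suff H : forall t n : nat,
    u n t%:Z = v n t%:Z /\ ((0 < n)%N -> u n (t%:Z - 1) = v n (t%:Z - 1)).
  by move=> n t; case: (H t n).
elim=> [|t IH] n.
  case: n => [|n]; first by rewrite bu bv.
  by have [//|-> ->] := iu n.+1; have [//|-> ->] := iv n.+1.
have e1 : t.+1%:Z = t%:Z + 1 by rewrite -PoszD addn1.
split; last by move=> _; rewrite e1 addrK; case: (IH n).
case: n => [|n]; first by rewrite bu bv.
rewrite e1; have := eu n.+1 t isT; rewrite -(ev n.+1 t isT) /=.
have [-> _] := IH n; have [-> _] := IH n.+2.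
have [-> /(_ isT) ->] := IH n.+1.
by do 4! move/addIr.
Qed.

(* Main.v *)
(* Gauge transformation: if u solves the system for a and s_i^2 = 1 for i >= 1,
   then (s_0 ... s_{n-1}) u_{n,t} solves the system for (s_i a_i).  Both claims
   follow from uniqueness: s flips one sign in the first, and s = a'/a in the
   second, where the factor at n = 1 is s_0 = 1. *)
Require Import Defs.
From mathcomp Require Import all_boot all_order all_algebra.
From mathcomp Require Import reals.
From mathcomp Require Import complex ring.
Set Implicit Arguments.
Unset Strict Implicit.
Unset Printing Implicit Defensive.
Import Order.TTheory GRing.Theory Num.Theory.
Local Open Scope ring_scope.
Local Open Scope complex_scope.

(** In the equation at a site m, every term acquires the weight s_0 ... s_{m-1} of that site: the
    left neighbour lacks s_{m-1} but gains it from [a'], while the right neighbour ends up with s_m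
    ^ 2 = 1. At the boundary the product is empty, so [f] is kept. *)
Lemma is_solution_gauge (R : realType) (a a' b f s : nat -> R[i])
    (u : nat -> int -> R[i]) :
  (forall i, (0 < i)%N -> s i ^+ 2 = 1) -> (forall i, a' i = s i * a i) ->
  is_solution a b f u ->
  is_solution a' b f (fun n t => (\prod_(i < n) s i) * u n t).
Proof.
move=> s2 a'E [eqn init bnd]; split.
- case=> [//|n] t _; have := eqn n.+1 t isT; rewrite !a'E /= => eq_u.
  rewrite [\prod_(i < n.+2) _]big_ord_recr [\prod_(i < n.+1) _]big_ord_recr /=.
  set p := \prod_(i < n) s i.
  (* The right-hand side 0 becomes the weight of site n+1 times the equation for [u] there. *)
  rewrite -[RHS](mulr0 (p * s n)) -eq_u.
  have -> : s n.+1 * a n.+1 * (p * s n * s n.+1 * u n.+2 t) =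
      s n.+1 ^+ 2 * (p * s n * (a n.+1 * u n.+2 t)) by ring.
  by rewrite s2 //; ring.
- by move=> n n_gt0; have [-> ->] := init n n_gt0; rewrite !mulr0.
- by move=> t; rewrite big_ord0 mul1r.
Qed.

Lemma solution_map_gauge (R : realType)
    (u : (nat -> R[i]) -> (nat -> R[i]) -> (nat -> R[i]) ->
         nat -> int -> R[i])
    (a a' b f s : nat -> R[i]) (n t : nat) :
  solution_map u -> nonvanishing a -> nonvanishing a' ->
  (forall i, (0 < i)%N -> s i ^+ 2 = 1) -> (forall i, a' i = s i * a i) ->
  u a' b f n t%:Z = (\prod_(i < n) s i) * u a b f n t%:Z.
Proof.
move=> hu a0 a'0 s2 a'E.
exact: (solution_unique (hu _ b f a'0)
  (is_solution_gauge s2 a'E (hu _ b f a0)) n t).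
Qed.

(** The gauge is s_i = -1 at i = j and 1 elsewhere; its product over i < n contains the factor -1
    exactly when j < n. *)
Lemma solution_map_flip_sign (R : realType)
    (u : (nat -> R[i]) -> (nat -> R[i]) -> (nat -> R[i]) ->
         nat -> int -> R[i])
    (a b f : nat -> R[i]) (j n t : nat) :
  solution_map u -> nonvanishing a ->
  u (flip_sign j a) b f n t%:Z = (-1) ^+ (j < n)%N * u a b f n t%:Z.
Proof.
move=> hu a0.
have -> : (-1) ^+ (j < n)%N = \prod_(i < n) (-1) ^+ (val i == j) :> R[i].
  elim: n => [|n IH]; first by rewrite big_ord0.
  (* j <= n splits into the exclusive cases j < n and j = n, so the two signs combine as an
     exclusive or. *)
  by rewrite big_ord_recr /= -IH -signr_addb ltnS; case: ltngtP.
apply: (@solution_map_gauge _ _ a _ _ _ (fun i => (-1) ^+ (i == j))) => // i.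
- by rewrite /flip_sign; case: (i == j); rewrite ?oppr_eq0 a0.
- by rewrite sqrr_sign.
- by rewrite /flip_sign; case: (i == j); rewrite ?mulN1r ?mul1r.
Qed.

Theorem theorem3 (R : realType)
    (u : (nat -> R[i]) -> (nat -> R[i]) -> (nat -> R[i]) ->
         nat -> int -> R[i])
    (hu : solution_map u) :
  (forall (b f : nat -> R[i]) (n t : nat), (0 < n)%N -> (0 < t)%N ->
     (forall j : nat, (1 <= j <= n.-1)%N ->
        odd_wrt j (fun a => u a b f n t%:Z)) /\
     (forall j : nat, (n <= j)%N ->
        even_wrt j (fun a => u a b f n t%:Z))) /\
  (forall b a a' : nat -> R[i], nonvanishing a -> nonvanishing a' ->
     a 0%N = a' 0%N ->
     (forall i : nat, (1 <= i)%N -> a i ^+ 2 = a' i ^+ 2) ->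
     response u a b =1 response u a' b).
Proof.
split=> [b f n t n_gt0 _|b a a' a0 a'0 e0 e2 k].
  split=> j hj a a0; rewrite solution_map_flip_sign //.
    have -> : (j < n)%N by case/andP: hj => _; rewrite -ltnS prednK.
    by rewrite mulN1r.
  by rewrite ltnNge hj mul1r.
rewrite /response.
(* The gauge carries [a'] to [a]; equality of squares makes each ratio with i >= 1 square to 1. *)
rewrite (@solution_map_gauge _ _ a' a _ _ (fun i => a i / a' i)) //.
(* At site 1 the weight is the single ratio a_0 / a'_0, equal to 1 since the two sequences agree at
   0. *)
- by rewrite big_ord1 e0 divff // mul1r.
- by move=> i i_gt0; rewrite expr_div_n e2 // divff // expf_neq0.
- by move=> i; rewrite divfK.
Qed.
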